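(* For $i=1,2$ and $j=3-i$, let $X_{i,o}\subset\mathbb R$ and $\Theta_i\subset\mathbb R$ be closed bounded intervals, and let $u_i(x,\theta_i)$, $x=(x_1,x_2)\in X_{1,o}\times X_{2,o}$, be the real-valued reward of player $i$, which is continuous in $(x,\theta_i)$ and has a unique maximizer $x_i(x_j,\theta_i)$ over $x_i\in X_{i,o}$ for every $(x_j,\theta_i)$; assume also that the full information game with these rewards has at least one pure Nash equilibrium. Assume that, for $i=1,2$, the best response $r_i(X_j,\theta_i,\pi_i)$ is single-valued and continuous in $X_j$, $\theta_i$ and $\pi_i$. Then, for attitudes $\pi=(\pi_1,\pi_2)\in[0,1]^2$, there exists an uncertainty equilibrium $(X_1^*(\pi),X_2^*(\pi))$.
   Context: Player $i$ knows her type $\theta_i\in\Theta_i$ but only that $\theta_j\in\Theta_j$; this is common knowledge. Player $i$ has an attitude $\pi_i\in[0,1]$. If player $i$ believes $x_j\in X_j\subset X_{j,o}$, she maximizes over $x_i\in X_{i,o}$ the quantity $$f_i(x_i,X_j,\theta_i,\pi_i)=\pi_i\max_{x_j\in X_j}u_i(x,\theta_i)+(1-\pi_i)\min_{x_j\in X_j}u_i(x,\theta_i).$$ The best response is $r_i(X_j,\theta_i,\pi_i)=\arg\max_{x_i\in X_{i,o}}f_i(x_i,X_j,\theta_i,\pi_i)$, and $\psi_i(X_j;\pi_i)=\bigcup_{\theta_i\in\Theta_i}r_i(X_j,\theta_i,\pi_i)$. Here $X_j$ ranges over nonempty closed subintervals $[\underline x_j,\overline x_j]$ of $X_{j,o}$,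 and continuity in $X_j$ means continuity in the endpoints $(\underline x_j,\overline x_j)$. A pair of sets $(X_1,X_2)$ is an uncertainty equilibrium for players with attitudes $\pi$ if $X_i=\psi_i(X_j;\pi_i)$ for $i=1,2$ and $j=3-i$. *)

(* Defs.v *)
From mathcomp Require Import all_boot all_order all_algebra.
From mathcomp Require Import all_classical all_reals all_analysis.
Import Order.TTheory GRing.Theory Num.Theory.
Import numFieldNormedType.Exports.

Set Implicit Arguments.
Unset Strict Implicit.
Unset Printing Implicit Defensive.

Local Open Scope classical_set_scope.
Local Open Scope ring_scope.

Variant player := player1 | player2.

Definition opponent (i : player) : player :=
  if i is player1 then player2 else player1.

Definition coord (R : realType) (x : R * R) (i : player) : R :=
  if i is player1 then x.1 else x.2.

(** The profile (x_1, x_2) in which [i] plays [xi] and the other player plays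
    [xj]. *)
Definition profile (R : realType) (i : player) (xi xj : R) : R * R :=
  if i is player1 then (xi, xj) else (xj, xi).

Definition closed_bounded_interval (R : realType) (A : set R) : Prop :=
  exists a b : R, a <= b /\ A = `[a, b]%classic.

Definition argmax (R : realType) (A : set R) (g : R -> R) : set R :=
  [set x | A x /\ forall y, A y -> g y <= g x].

(** [strategies i] is X_{i,o} and [types i] is Theta_i.  Rewards are total
    functions, but only their values on X_{1,o} x X_{2,o} x Theta_i matter. *)
Record game (R : realType) := Game {
  strategies : player -> set R;
  types : player -> set R;
  reward : player -> R * R -> R -> R
}.

Section Game.
Variables (R : realType) (G : game R).

Definition continuous_rewards : Prop :=
  forall i : player,
    {within (strategies G player1 `*` strategies G player2) `*` types G i,
      continuous (fun z : (R * R) * R => reward G i z.1 z.2)}.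

Definition unique_maximizers : Prop :=
  forall (i : player) (xj t : R),
    strategies G (opponent i) xj -> types G i t ->
    exists! xi : R,
      argmax (strategies G i) (fun y => reward G i (profile i y xj) t) xi.

Definition pure_nash (theta : player -> R) (x : R * R) : Prop :=
  forall i : player,
    argmax (strategies G i)
      (fun y => reward G i (profile i y (coord x (opponent i))) (theta i))
      (coord x i).

(** For a continuous reward and a nonempty compact [Xj] the supremum and the
    infimum are attained, hence are the maximum and the minimum over [Xj]. *)
Definition payoff (i : player) (xi : R) (Xj : set R) (t p : R) : R :=
  p * sup [set reward G i (profile i xi xj) t | xj in Xj] +
  (1 - p) * inf [set reward G i (profile i xi xj) t | xj in Xj].

Definition best_response (i : player) (Xj : set R) (t p : R) : set R :=
  argmax (strategies G i) (fun xi => payoff i xi Xj t p).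

Definition response_set (i : player) (Xj : set R) (p : R) : set R :=
  \bigcup_(t in types G i) best_response i Xj t p.

(** Pairs of endpoints of the nonempty closed subintervals of X_{i,o}. *)
Definition endpoints (i : player) : set (R * R) :=
  [set e | e.1 <= e.2 /\ `[e.1, e.2]%classic `<=` strategies G i].

(** The best response is a singleton, whose element is jointly continuous in
    the endpoints of the opponent's interval, the type and the attitude. *)
Definition single_valued_continuous_best_response (i : player) : Prop :=
  exists r : (R * R) * R * R -> R,
    (forall (e : R * R) (t p : R),
       endpoints (opponent i) e -> types G i t -> 0 <= p <= 1 ->
       best_response i `[e.1, e.2]%classic t p = [set r (e, t, p)]) /\
    {within endpoints (opponent i) `*` types G i `*` `[0, 1]%classic, continuous r}.

(** [X] is the pair (X_1, X_2); the sets range over nonempty closed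
    subintervals, on which the response sets are defined. *)
Definition uncertainty_equilibrium (p : player -> R) (X : player -> set R)
    : Prop :=
  forall i : player,
    [/\ closed_bounded_interval (X i),
        X i `<=` strategies G i &
        X i = response_set i (X (opponent i)) (p i)].

End Game.

(* Main.v *)
(** The response sets are compact intervals whose endpoints depend continuously on
    those of the opponent's interval, so an equilibrium is a fixed point of the
    composite of the two response maps, a continuous self-map of the triangle of
    endpoint pairs of player 1.  Retracting the plane onto this triangle turns it
    into a self-map of a square, to which Brouwer's theorem applies.  The latter is
    obtained from Sperner's lemma on a square grid: modulo 2, the numbers of
    (0,1)-edges around all cells add up to the number on the boundary, which is odd. *)

Require Import Defs.
From mathcomp Require Import all_boot all_order all_algebra.
From mathcomp Require Import all_classical all_reals all_analysis.
From mathcomp Require Import lra.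
Import Order.TTheory GRing.Theory Num.Theory.
Import numFieldNormedType.Exports.
Set Implicit Arguments.
Unset Strict Implicit.
Local Open Scope classical_set_scope.
Local Open Scope ring_scope.

(** * Sperner's lemma modulo 2 *)

Definition edge01 (u v : option bool) : bool :=
  if (u, v) is (Some a, Some b) then a (+) b else false.

(** Around a cell, an odd number of edges join [Some false] to [Some true] only
    if the third label [None] occurs as well. *)
Lemma odd_cell_labels (a b c d : option bool) :
  edge01 a b (+) edge01 c d (+) (edge01 a c (+) edge01 b d) ->
  forall l, l \in [:: a; b; c; d].
Proof.
by case: a b c d => [[]|] [[]|] [[]|] [[]|] //= _ [[]|].
Qed.

(** If no cell carries all three labels, every cell has an even number of (0,1)-edges. The left and
    right sides have none, so all rows have the same parity; but the top row has none, while the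
    bottom row passes from [Some false] to [Some true]. *)
Lemma sperner_square (n : nat) (c : nat -> nat -> option bool) :
  (forall j, (j <= n)%N -> c 0%N j != Some true) ->
  (forall j, (j <= n)%N -> c n j = Some true) ->
  (forall i, (i <= n)%N -> c i 0%N != None) ->
  (forall i, (i <= n)%N -> c i n != Some false) ->
  exists i j, [/\ (i < n)%N, (j < n)%N &
    forall l, l \in [:: c i j; c i.+1 j; c i j.+1; c i.+1 j.+1]].
Proof.
move=> left right bottom top; apply: contrapT => none.
have cell i j : (i < n)%N -> (j < n)%N ->
    edge01 (c i j) (c i.+1 j) (+) edge01 (c i j.+1) (c i.+1 j.+1) =
    edge01 (c i j) (c i j.+1) (+) edge01 (c i.+1 j) (c i.+1 j.+1).
  move=> ltin ltjn; apply/eqP; rewrite -negb_add; apply/negP => odd.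
  by apply: none; exists i, j; split=> //; exact: odd_cell_labels.
pose row j k := \big[addb/false]_(i < k) edge01 (c i j) (c i.+1 j).
(* Vertical edges shared by adjacent cells cancel modulo 2, which leaves the two outermost ones. *)
have strip j k : (k <= n)%N -> (j < n)%N ->
    row j k (+) row j.+1 k =
    edge01 (c 0%N j) (c 0%N j.+1) (+) edge01 (c k j) (c k j.+1).
  move=> + ltjn; elim: k => [|k IHk] lekn; first by rewrite /row !big_ord0 !addbb.
  by rewrite /row !big_ord_recr /= addbACA IHk 1?ltnW// cell// addbA addbK.
have row_stable j : (j <= n)%N -> row j n = row 0%N n.
  elim: j => // j IHj ltjn; rewrite -IHj 1?ltnW//.
  apply/esym/eqP; rewrite -negb_add strip// (right _ ltjn) (right _ (ltnW ltjn)).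
  have := left _ ltjn; have := left _ (ltnW ltjn).
  by case: (c 0%N j) (c 0%N j.+1) => [[]|] [[]|].
have row_top : row n n = false.
  rewrite /row big1// => i _.
  have := top i (ltnW (ltn_ord i)); have := top i.+1 (ltn_ord i).
  by case: (c i n) (c i.+1 n) => [[]|] [[]|].
(* Without [None], a label records the parity of the changes made since the corner, which is
   labelled [Some false]. *)
have row_bottom k : (k <= n)%N -> c k 0%N = Some (row 0%N k).
  elim: k => [_|k IHk ltkn].
    rewrite /row big_ord0; have := left 0%N (leq0n n); have := bottom 0%N (leq0n n).
    by case: (c 0%N 0%N) => [[]|].
  rewrite /row big_ord_recr /= -/(row 0%N k).
  have := bottom _ ltkn; rewrite IHk 1?ltnW//.
  by case: (c k.+1 0%N) (row 0%N k) => [[]|] [].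
by have := right 0%N (leq0n n); rewrite row_bottom// -(row_stable n (leqnn n)) row_top.
Qed.

(** * The Poincaré-Miranda and Brouwer theorems on a square *)

Section poincare_miranda.
Variable R : realType.
Implicit Types (f g : R * R -> R) (a b : R).

(** Otherwise, by compactness, one radius [e] excludes the sign pattern of [P] around every point of
    the square. On a grid of mesh below [e], labels recording signs of [f] and [g] meet Sperner's
    boundary conditions, and the cell obtained shows that pattern. *)
Lemma poincare_miranda_square a b f g : a <= b ->
  continuous f -> continuous g ->
  (forall y, a <= y <= b -> 0 <= f (a, y)) ->
  (forall y, a <= y <= b -> f (b, y) <= 0) ->
  (forall x, a <= x <= b -> 0 <= g (x, a)) ->
  (forall x, a <= x <= b -> g (x, b) <= 0) ->
  exists z, [/\ a <= z.1 <= b, a <= z.2 <= b, f z = 0 & g z = 0].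
Proof.
move=> ab cf cg fa fb ga gb; apply: contrapT => nozero.
pose K := `[a, b]%classic `*` `[a, b]%classic : set (R * R).
have Kcov : near_covering K.
  by apply/compact_near_coveringP/compact_setX; exact: segment_compact.
(* The three labels of a cell are located at [u], [v] and [w]; [P e] says that no
   such cell lies within [e] of [x]. *)
pose P (e : R) (x : R * R) := forall u v w : R * R,
  ball x e u -> ball x e v -> ball x e w ->
  ~ [/\ f u <= 0, 0 <= f v, g v <= 0, 0 <= f w & 0 <= g w].
have pos (h : R * R -> R) x : continuous h -> 0 < h x ->
    exists2 e : R, 0 < e & forall y, ball x e y -> 0 < h y.
  move=> ch hx; have : \forall y \near x, 0 < h y by exact: (cvgr_gt (h x) (ch x)).
  by move=> /nbhs_ballP[e /= e0 he]; exists e.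
have neg (h : R * R -> R) x : continuous h -> h x < 0 ->
    exists2 e : R, 0 < e & forall y, ball x e y -> h y < 0.
  move=> ch hx; have : \forall y \near x, h y < 0 by exact: (cvgr_lt (h x) (ch x)).
  by move=> /nbhs_ballP[e /= e0 he]; exists e.
have avoid x : K x -> exists2 e : R, 0 < e & P e x.
  move=> [/= x1 x2]; have : ~ (f x = 0 /\ g x = 0).
    move=> [fx gx]; apply: nozero; exists x.
    by move: x1 x2; rewrite !in_itv.
  have [fx _|fx _|fx] := ltgtP (f x) 0.
  - have [e e0 he] := neg f x cf fx; exists e => // u v w _ /he vx _ [_ + _ _ _].
    by rewrite leNgt vx.
  - have [e e0 he] := pos f x cf fx; exists e => // u v w /he ux _ _ [+ _ _ _ _].
    by rewrite leNgt ux.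
  have [gx _|gx _|gx []//] := ltgtP (g x) 0.
  - have [e e0 he] := neg g x cg gx; exists e => // u v w _ _ /he wx [_ _ _ _].
    by rewrite leNgt wx.
  - have [e e0 he] := pos g x cg gx; exists e => // u v w _ /he vx _ [_ _ + _ _].
    by rewrite leNgt vx.
(* The local radii from [avoid] are made uniform, as with a Lebesgue number. *)
have [e e0 Pe] : exists2 e : R, 0 < e & K `<=` P e.
  have : \forall e \near 0^'+, K `<=` P e.
    apply: Kcov => x /avoid[e e0 Pe].
    exists (ball x (e / 2), [set d : R | 0 < d < e / 2]) => /=.
      split; first by apply: nbhsx_ballx; rewrite divr_gt0.
      near=> d => /=; apply/andP; split; near: d; first exact: nbhs_right_gt.
      by apply: nbhs_right_lt; rewrite divr_gt0.
    move=> [y d] /= [xy /andP[d0 de]] u v w yu yv yw; apply: Pe;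
      by rewrite [e]splitr; apply: (ball_triangle xy); apply: le_ball (ltW de) _ _.
  move=> H; have [e [e0 Pe]] : exists e : R, 0 < e /\ K `<=` P e.
    apply: (@filter_ex _ (0^'+ : set_system R)); near=> e; split; near: e => //.
    exact: nbhs_right_gt.
  by exists e.
(* The successor makes the mesh strictly smaller than [e] and keeps [n] positive when [a = b]. *)
pose n := (Num.truncn ((b - a) / e)).+1.
have n0 : 0 < n%:R :> R by rewrite ltr0n.
have step : (b - a) / n%:R < e.
  rewrite ltr_pdivrMr// mulrC -ltr_pdivrMr//; exact: truncnS_gt.
pose t (k : nat) : R := a + (b - a) / n%:R * k%:R.
have t0 : t 0%N = a by rewrite /t mulr0 addr0.
have tn : t n = b by rewrite /t divfK ?gt_eqF// addrC subrK.
have h0 : 0 <= (b - a) / n%:R by rewrite divr_ge0 ?subr_ge0// ltW.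
have tab k : (k <= n)%N -> a <= t k <= b.
  move=> kn; rewrite -tn /t lerDl mulr_ge0//= lerD2l ler_wpM2l//.
  by rewrite ler_nat.
(* The tests [0 < i] and [0 < j] force Sperner's boundary condition where [f] or
   [g] vanishes on the sides. *)
pose c i j : option bool :=
  if (0 < i)%N && (f (t i, t j) <= 0) then Some true
  else if (0 < j)%N && (g (t i, t j) <= 0) then None else Some false.
have [] := @sperner_square n c.
- by move=> j jn; rewrite /c /=; case: ifP.
- by move=> j jn; rewrite /c /= tn fb ?tab.
- by move=> i iin; rewrite /c /=; case: ifP.
- by move=> i iin; rewrite /c /= tn gb ?tab//; case: ifP.
move=> i [j [ltin ltjn all_labels]].
have near_corner l : exists i' j', [/\ (i' <= n)%N, (j' <= n)%N, 
    ball (t i, t j) e (t i', t j') & c i' j' = l].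
  have tS k : ball (t k) e (t k.+1).
    rewrite /ball /= /t opprD addrACA subrr add0r -mulrBr.
    by rewrite -natr1 opprD addNKr mulrN1 normrN ger0_norm.
  have tk k : ball (t k) e (t k) by exact: ballxx.
  by have := all_labels l; rewrite !inE => /or4P[] /eqP->;
    [exists i, j|exists i.+1, j|exists i, j.+1|exists i.+1, j.+1]; split=> //;
    first [exact: ltnW|by split; first [exact: tS|exact: tk]].
have Kij : K (t i, t j) by split; rewrite /= in_itv /= tab// ltnW.
have [iu [ju [_ _ bu cu]]] := near_corner (Some true).
have [iv [jv [ivn jvn bv cv]]] := near_corner None.
have [iw [jw [iwn jwn bw cw]]] := near_corner (Some false).
apply: (Pe _ Kij _ _ _ bu bv bw).
(* On the left side the label says nothing about [f]; there the sign comes from [fa]. *)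
have fge0 i' j' : (i' <= n)%N -> (j' <= n)%N -> c i' j' != Some true ->
    0 <= f (t i', t j').
  move=> i'n j'n; rewrite /c; case: posnP => [->|_] /=; first by rewrite t0 fa ?tab.
  by case: ifPn => //; rewrite -ltNge => /ltW.
split.
- by move: cu; rewrite /c; case: ifPn => [/andP[]//|_]; case: ifP.
- by apply: fge0 => //; rewrite cv.
- by move: cv; rewrite /c; case: ifP => // _; case: ifPn => [/andP[]|].
- by apply: fge0 => //; rewrite cw.
- move: cw; rewrite /c; case: ifP => // _.
  case: posnP => [-> _|_] /=; first by rewrite t0 ga ?tab.
  by case: ifPn => //; rewrite -ltNge => /ltW.
Unshelve. all: by end_near.
Qed.

(** The displacement [F z - z] points inwards on each side of the square, so both of its coordinates
    vanish together somewhere. *)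
Lemma brouwer_square a b (F : R * R -> R * R) : a <= b -> continuous F ->
  (forall z, a <= (F z).1 <= b /\ a <= (F z).2 <= b) -> exists z, F z = z.
Proof.
move=> ab cF Fab.
have c1 : continuous (fun z => (F z).1 - z.1).
  by move=> z; apply: cvgB; [apply: cvg_comp (cF z) _|]; exact: cvg_fst.
have c2 : continuous (fun z => (F z).2 - z.2).
  by move=> z; apply: cvgB; [apply: cvg_comp (cF z) _|]; exact: cvg_snd.
have [] := poincare_miranda_square ab c1 c2.
- by move=> y _ /=; rewrite subr_ge0; have [/andP[]] := Fab (a, y).
- by move=> y _ /=; rewrite subr_le0; have [/andP[]] := Fab (b, y).
- by move=> x _ /=; rewrite subr_ge0; have [_ /andP[]] := Fab (x, a).
- by move=> x _ /=; rewrite subr_le0; have [_ /andP[]] := Fab (x, b).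
move=> z [_ _ /eqP + /eqP]; rewrite !subr_eq0 => /eqP z1 /eqP z2.
by exists z; rewrite [LHS]surjective_pairing z1 z2 -surjective_pairing.
Qed.

End poincare_miranda.

(** * Continuity of the image of a segment under a parametrized map *)

Lemma continuous_pair (T U V : topologicalType) (f : T -> U) (g : T -> V) :
  continuous f -> continuous g -> continuous (fun x => (f x, g x)).
Proof. by move=> cf cg x; exact: (cvg_pair (cf x) (cg x)). Qed.

Lemma continuous_comp_within (T U V : topologicalType) (A : set U)
    (r : U -> V) (h : T -> U) :
  {within A, continuous r} -> continuous h -> (forall x, A (h x)) ->
  continuous (r \o h).
Proof.
move=> cr ch Ah x B /(cr (h x)); rewrite /= nbhs_simpl.
rewrite /nbhs/= -nbhs_subspace_in//.
by move=> /ch hB; apply: (@filterS _ (nbhs x) _ _ _ _ hB) => y; exact.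
Qed.

Section segment_image.
Variables (R : realType) (T : topologicalType).

(** The endpoints are the minimum and maximum of [g (e, _)], and the intermediate value theorem
    fills the gap. They vary continuously because [g (e', _)] is uniformly close to [g (e, _)] on
    the compact segment. *)
Lemma segment_image_endpoints (a b : R) (g : T * R -> R) :
  a <= b -> continuous g ->
  exists2 F : T -> R * R, continuous F &
    forall e, (F e).1 <= (F e).2 /\
      [set g (e, t) | t in `[a, b]] = `[(F e).1, (F e).2]%classic.
Proof.
move=> ab cg.
have cge e : continuous (fun t => g (e, t)).
  have ce : continuous (fun t : R => (e, t)).
    by apply: continuous_pair => x; [exact: cvg_cst|exact: cvg_id].
  by move=> t; exact: cvg_comp (ce t) (cg (e, t)).
have /choice[st ext] e : exists st : R * R, [/\ st.1 \in `[a, b], st.2 \in `[a, b] &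
    forall t, t \in `[a, b] -> g (e, st.1) <= g (e, t) <= g (e, st.2)].
  have [s sab smin] := EVT_min ab (continuous_subspaceT (cge e)).
  have [t tab tmax] := EVT_max ab (continuous_subspaceT (cge e)).
  by exists (s, t); split=> //= u uab; rewrite smin ?tmax.
have unif e (eps : R) : 0 < eps ->
    \forall e' \near e, forall t, t \in `[a, b] -> `|g (e', t) - g (e, t)| < eps.
  move=> eps0.
  have Kcov : near_covering `[a, b]%classic.
    by apply/compact_near_coveringP; exact: segment_compact.
  apply: (Kcov _ (nbhs e) (fun e' t => `|g (e', t) - g (e, t)| < eps)) => t _.
  have : \forall z \near (e, t), `|g (e, t) - g z| < eps / 2.
    by have /cvgrPdist_lt := cg (e, t); apply; rewrite divr_gt0.
  move=> [[A B] /= [Ae Bt] AB]; exists (B, A) => //= -[t' e'] /= [Bt' Ae'].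
  rewrite [eps]splitr (le_lt_trans (ler_distD (g (e, t)) _ _))// ltrD//.
    by rewrite distrC; exact: (AB (e', t')).
  by apply: (AB (e, t')); split=> //=; exact: nbhs_singleton.
exists (fun e => (g (e, (st e).1), g (e, (st e).2))) => [|e].
  (* Extremizers need not vary continuously; only extremal values are compared, each function being
     evaluated at the extremizers of the other. *)
  by apply: continuous_pair => e; apply/cvgrPdist_lt => eps eps0; near=> e';
    have [s1 s2 sext] := ext e; have [s1' s2' sext'] := ext e';
    have near_e' : forall t, t \in `[a, b] -> `|g (e', t) - g (e, t)| < eps
      by [near: e'; exact: unif];
    have /andP[? ?] := sext _ s1'; have /andP[? ?] := sext _ s2';
    have /andP[? ?] := sext' _ s1; have /andP[? ?] := sext' _ s2;
    have := near_e' _ s1; have := near_e' _ s2;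
    have := near_e' _ s1'; have := near_e' _ s2';
    rewrite !ltr_norml => /andP[? ?] /andP[? ?] /andP[? ?] /andP[? ?]; lra.
have [s1 s2 sext] := ext e; split=> /=; first by have /andP[] := sext _ s2.
apply/seteqP; split=> [_ [t tab <-]|v vF] /=; first by rewrite in_itv/= sext.
(* The minimizer may lie to the right of the maximizer. *)
pose s := Num.min (st e).1 (st e).2; pose t := Num.max (st e).1 (st e).2.
have st_le : s <= t by rewrite ge_min le_max lexx.
have [||u ust <-] := @IVT _ (fun t => g (e, t)) s t v st_le.
- exact: continuous_subspaceT.
- move: vF; rewrite /s /t /= in_itv /= => /andP[].
  by case: (leP (st e).1 (st e).2) => _; rewrite ge_min le_max => -> ->; rewrite ?orbT.
exists u => //=; move: ust s1 s2; rewrite !in_itv /= /s /t ge_min le_max.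
by move=> /andP[/orP[] + /orP[]]; lra.
Unshelve. all: by end_near.
Qed.

End segment_image.

(** * Retraction onto endpoint pairs *)

Section order_clamp.
Variables (R : realType) (a b : R).

Definition clamp (x : R) : R := Num.max a (Num.min x b).

(** A retraction of the plane onto the pairs of endpoints of the nonempty
    closed subintervals of [`[a, b]]. *)
Definition clamp_endpoints (e : R * R) : R * R :=
  (clamp (Num.min e.1 e.2), clamp (Num.max e.1 e.2)).

Lemma clamp_bounds x : a <= b -> a <= clamp x <= b.
Proof. by move=> ab; rewrite /clamp le_max lexx ge_max ab ge_min lexx orbT. Qed.

Lemma clamp_id x : a <= x <= b -> clamp x = x.
Proof. by move=> /andP[ax xb]; rewrite /clamp (min_idPl xb); exact/max_idPr. Qed.

Lemma clamp_homo : {homo clamp : x y / x <= y}.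
Proof.
move=> x y xy; rewrite /clamp ge_max le_max lexx/= le_max.
by apply/orP; right; rewrite le_min !ge_min lexx xy orbT.
Qed.

Lemma continuous_clamp : continuous clamp.
Proof.
move=> x; apply: (@continuous_max _ _ (cst a) (fun y => Num.min y b)).
  exact: cvg_cst.
by apply: (@continuous_min _ _ idfun (cst b)); [exact: cvg_id|exact: cvg_cst].
Qed.

Lemma continuous_clamp_endpoints : continuous clamp_endpoints.
Proof.
apply: continuous_pair => e.
  apply: (@continuous_comp _ _ _ (fun e : R * R => Num.min e.1 e.2) clamp).
    by apply: (@continuous_min _ _ fst snd); [exact: cvg_fst|exact: cvg_snd].
  exact: continuous_clamp.
apply: (@continuous_comp _ _ _ (fun e : R * R => Num.max e.1 e.2) clamp).
  by apply: (@continuous_max _ _ fst snd); [exact: cvg_fst|exact: cvg_snd].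
exact: continuous_clamp.
Qed.

End order_clamp.

(** * Response maps and equilibrium *)

(** The response set is the image of the type segment under the single-valued best response.
    Precomposing with retractions makes [F] total and continuous; on genuine endpoint pairs they
    change nothing. *)
Lemma response_endpoints (R : realType) (G : game R) (p : R) (i : player) :
  closed_bounded_interval (strategies G (opponent i)) ->
  closed_bounded_interval (types G i) ->
  single_valued_continuous_best_response G i -> 0 <= p <= 1 ->
  exists2 F : R * R -> R * R, continuous F & forall e,
    endpoints G i (F e) /\
    (endpoints G (opponent i) e ->
     response_set G i `[e.1, e.2]%classic p = `[(F e).1, (F e).2]%classic).
Proof.
move=> [s [s' [ss' strategiesE]]] [a [b [ab typesE]]] [r [bestE cr]] p01.
pose rho := clamp_endpoints s s'.
pose h (z : (R * R) * R) := (rho z.1, clamp a b z.2, p).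
have rho_endpoints e : endpoints G (opponent i) (rho e).
  split; first by apply: clamp_homo; rewrite ge_min le_max lexx.
  move=> y; rewrite strategiesE /= !in_itv /= => /andP[ly yu].
  have /andP[l _] := clamp_bounds (Num.min e.1 e.2) ss'.
  have /andP[_ u] := clamp_bounds (Num.max e.1 e.2) ss'.
  by rewrite (le_trans l ly) (le_trans yu u).
have ch : continuous h.
  apply: continuous_pair; last by move=> z; exact: cvg_cst.
  apply: continuous_pair => z.
    apply: (@continuous_comp _ _ _ fst rho); first exact: cvg_fst.
    exact: continuous_clamp_endpoints.
  apply: (@continuous_comp _ _ _ snd (clamp a b)); first exact: cvg_snd.
  exact: continuous_clamp.
have hA z : (endpoints G (opponent i) `*` types G i `*` `[0, 1]%classic) (h z).
  by split; [split|]; rewrite /= ?in_itv//= typesE /= in_itv /= clamp_bounds.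
have [F cF FE] := segment_image_endpoints ab (continuous_comp_within cr ch hA).
have bestF e t : t \in `[a, b] ->
    best_response G i `[(rho e).1, (rho e).2]%classic t p = [set r (h (e, t))].
  by move=> tab; rewrite bestE// ?typesE// /h /= clamp_id.
exists F => // e; have [F12 imE] := FE e; split.
  split=> // y; rewrite -imE => -[t /(bestF e) best <-].
  have sub : [set r (h (e, t))] `<=` strategies G i by rewrite -best => z [].
  exact: sub.
move=> [e12 esub]; have rhoe : rho e = e.
  have := esub e.1; have := esub e.2.
  rewrite strategiesE /= !in_itv /= !lexx e12 => /(_ isT) e2 /(_ isT) e1.
  by rewrite /rho /clamp_endpoints (min_idPl e12) (max_idPr e12) !clamp_id;
    case: e {e12 esub imE F12} e1 e2.
rewrite -imE /response_set typesE; apply/seteqP; split=> y.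
  by move=> [t tab]; have := bestF e t tab; rewrite rhoe => -> ->; exists t.
by move=> [t tab <-]; exists t => //; have := bestF e t tab; rewrite rhoe => ->.
Qed.

Theorem theorem5 (R : realType) (G : game R)
  (hX : forall i : player, closed_bounded_interval (strategies G i))
  (hT : forall i : player, closed_bounded_interval (types G i))
  (hu : continuous_rewards G)
  (hmax : unique_maximizers G)
  (hnash : forall theta : player -> R, (forall i : player, types G i (theta i)) ->
     exists x : R * R, pure_nash G theta x)
  (hr : forall i : player, single_valued_continuous_best_response G i)
  (p : player -> R) (hp : forall i : player, 0 <= p i <= 1) :
  exists X : player -> set R, uncertainty_equilibrium G p X.
Proof.
have [F1 cF1 F1P] := response_endpoints (hX _) (hT _) (hr player1) (hp player1).
have [F2 cF2 F2P] := response_endpoints (hX _) (hT _) (hr player2) (hp player2).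
have [a [b [ab strategiesE]]] := hX player1.
have cF : continuous (F1 \o F2) by move=> e; exact: cvg_comp (cF2 e) (cF1 _).
have [|z zE] := brouwer_square ab cF.
  move=> e; have [[le12]] := F1P (F2 e); rewrite strategiesE => sub _.
  have /= := sub (F1 (F2 e)).1; have /= := sub (F1 (F2 e)).2.
  by rewrite !in_itv /= !lexx le12 => /(_ isT) ? /(_ isT) ?.
(* A fixed point lies in the range of [F1], hence is a genuine endpoint pair. *)
have z_endpoints : endpoints G player1 z by rewrite -zE; exact: (F1P _).1.
have w_endpoints := (F2P z).1.
(* Player 2's set answers player 1's by construction; the converse is the fixed point equation. *)
exists (fun i => if i is player1 then `[z.1, z.2]%classic
                 else `[(F2 z).1, (F2 z).2]%classic).
have itv i e : endpoints G i e ->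
    closed_bounded_interval `[e.1, e.2]%classic /\ `[e.1, e.2]%classic `<=` strategies G i.
  by move=> [e12 sub]; split=> //; exists e.1, e.2.
case=> /=; split.
- exact: (itv _ _ z_endpoints).1.
- exact: (itv _ _ z_endpoints).2.
- by rewrite (F1P _).2// -/((F1 \o F2) z) zE.
- exact: (itv _ _ w_endpoints).1.
- exact: (itv _ _ w_endpoints).2.
- by rewrite (F2P _).2.
Qed.
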